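(* Let $b$ be an integer. Each of the following maps $R\colon \mathbb{Z}\times\mathbb{Z}\to\mathbb{Z}\times\mathbb{Z}$ gives a solution to the Braid equation on $\mathbb{Z}$: 1) $R(x,y)=(x,\,y)$; 2.1) $R(x,y)=(2y-x,\,x)$; 2.2) $R(x,y)=(y,\,2x-y)$; 3) $R(x,y)=(x,\,-x+b)$.
   Context: A map $R\colon X\times X\to X\times X$ is a solution to the Braid equation on the set $X$ if, as maps $X^3\to X^3$, $$(R\times\mathrm{id})(\mathrm{id}\times R)(R\times\mathrm{id})=(\mathrm{id}\times R)(R\times\mathrm{id})(\mathrm{id}\times R).$$ *)

(* Defs.v *)
From mathcomp Require Import all_boot all_order all_algebra.

Set Implicit Arguments.
Unset Strict Implicit.
Unset Printing Implicit Defensive.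

(* X^3 is X * X * X = (X * X) * X, so id x R involves a reassociation of triples. *)

Definition map_times_id (X : Type) (R : X * X -> X * X) (p : X * X * X) :
    X * X * X :=
  let: (x, y, z) := p in let: (x', y') := R (x, y) in (x', y', z).

Definition id_times_map (X : Type) (R : X * X -> X * X) (p : X * X * X) :
    X * X * X :=
  let: (x, y, z) := p in let: (y', z') := R (y, z) in (x, y', z').

Definition braid_solution (X : Type) (R : X * X -> X * X) : Prop :=
  map_times_id R \o id_times_map R \o map_times_id R
    =1 id_times_map R \o map_times_id R \o id_times_map R.

(* Main.v *)
Require Import Defs.
From mathcomp Require Import all_boot all_order all_algebra.
From mathcomp Require Import ring.
Import GRing.Theory.
Local Open Scope ring_scope.

(** Apart from the identity, the maps fall into two families.  The maps 2.1 and
    2.2 have the form [(x, y) |-> (op x y, x)] and [(x, y) |-> (y, op x y)]; for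
    such maps the two sides of the braid equation agree automatically in two of
    the three coordinates, and in the remaining one the equation is
    [op x (op y z) = op (op x y) (op x z)], respectively
    [op (op x y) z = op (op x z) (op y z)].  Both operations are affine
    combinations with coefficients [-1] and [2], and an affine combination in a
    commutative ring distributes over itself on both sides because its
    coefficients add up to [1].  The map 3 has the form [(x, y) |-> (x, f x)],
    which forgets its second argument: both sides of the braid equation send
    [(x, y, z)] to [(x, f x, f (f x))], whatever [f] is. *)

Lemma braid_self_left_distributive (X : Type) (op : X -> X -> X) :
  left_distributive op op ->
  braid_solution (fun p : X * X => let: (x, y) := p in (y, op x y)).
Proof. by move=> opD [[x y] z] /=; rewrite (opD x y z). Qed.

Lemma braid_self_right_distributive (X : Type) (op : X -> X -> X) :
  right_distributive op op ->
  braid_solution (fun p : X * X => let: (x, y) := p in (op x y, x)).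
Proof. by move=> opD [[x y] z] /=; rewrite (opD x y z). Qed.

Lemma braid_graph (X : Type) (f : X -> X) :
  braid_solution (fun p : X * X => let: (x, y) := p in (x, f x)).
Proof. by case=> [[x y] z]. Qed.

Theorem proposition4p7 (b : int) :
  [/\ braid_solution (fun p : int * int => let: (x, y) := p in (x, y)),
      braid_solution (fun p : int * int => let: (x, y) := p in (2 * y - x, x)),
      braid_solution (fun p : int * int => let: (x, y) := p in (y, 2 * x - y)) &
      braid_solution (fun p : int * int => let: (x, y) := p in (x, - x + b))].
Proof.
split.
- by case=> [[x y] z].
- apply: (@braid_self_right_distributive int (fun x y => 2 * y - x)).
  by move=> x y z /=; ring.
- apply: (@braid_self_left_distributive int (fun x y => 2 * x - y)).
  by move=> x y z /=; ring.
- exact: (@braid_graph int (fun x => - x + b)).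
Qed.
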